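(* Let $A$ be a finite alphabet, let $G$ be a group acting self-similarly on $A^*$ and let $a\in A$. Then there exist $T,d\in\mathbb{N}$ such that $\operatorname{Degree}_{\operatorname{Lan}_G(a)}(v)=d$ for all $v\in \operatorname{Lan}_G(a)$ with $|v|\geq T$. Furthermore, for any word $v\in A^*$, the following statements are equivalent: (1) $v\in \operatorname{Lan}_G(a)$; (2) all subwords of $v$ of length at most $T+1$ belong to $\operatorname{Lan}_G(a)$.
   Context: $A^*$ is the free monoid of finite words over $A$, $|v|$ the length of $v$; a subword of $v$ is a contiguous factor of $v$. Zappa–Szép product: a monoid $S$ with submonoids $X,Y$ is an internal Zappa–Szép product, $S=X\bowtie Y$, if every $s\in S$ can be written uniquely as $s=xy$ with $x\in X,y\in Y$. Then for $x\in X,y\in Y$ one defines $y\cdot x\in X$ and $y@x\in Y$ by $yx=(y\cdot x)(y@x)$; $\cdot$ is a left action of $Y$ on $X$, $@$ is a right action of $X$ on $Y$, and $y\cdot(x_1x_2)=(y\cdot x_1)((y@x_1)\cdot x_2)$, $(y_1y_2)@x=(y_1@(y_2\cdot x))(y_2@x)$. A group $G$ acts self-similarly on $A^*$ if there is a Zappa–Szép product $S=A^*\bowtie G$ such that the left action $\cdot$ of $G$ on $A^*$ is faithful and $G\cdot A=A$. Such an action is by automorphisms of the rooted tree $A^*$ (it preserves lengths of words and of longest common prefixes), so it extends to the set $A^\omega$ of right-infinite words. For $a\in A$, $a^\omega=aaa\dots$, and $\operatorname{Lan}_G(a)$ is the language of all (finite) prefixes of sequences in the orbit $G\cdot a^\omega$;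 equivalently $\operatorname{Lan}_G(a)=\bigsqcup_k G\cdot a^k$. For $v\in\operatorname{Lan}_G(a)$, $\operatorname{Degree}_{\operatorname{Lan}_G(a)}(v)=\#\{b\in A: vb\in\operatorname{Lan}_G(a)\}$. *)

(* Defs.v *)
From HB Require Import structures.
From mathcomp Require Import all_boot.
From mathcomp Require Import boolp.

Set Implicit Arguments.
Unset Strict Implicit.
Unset Printing Implicit Defensive.

Local Open Scope group_scope.

(* The free monoid A^*: finite words under concatenation. *)
HB.instance Definition _ (A : choiceType) :=
  isMonoid.Build (seq A) (@catA A) (@cat0s A) (@cats0 A).

(* S = X \bowtie Y; the submonoids X and Y of S are given by monoid
   embeddings. *)
Record zappa_szep (X Y : monoidType) := ZappaSzep {
  zs_sort :> monoidType;
  zs_inl : UMagmaMorphism.type X zs_sort;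
  zs_inr : UMagmaMorphism.type Y zs_sort;
  zs_inl_inj : injective zs_inl;
  zs_inr_inj : injective zs_inr;
  zs_factor : forall s : zs_sort,
    exists! p : X * Y, s = zs_inl p.1 * zs_inr p.2
}.

Section ZappaSzep.
Variables (X Y : monoidType) (S : zappa_szep X Y).

Lemma zs_factor_ex (s : S) :
  exists p : X * Y, s == zs_inl S p.1 * zs_inr S p.2.
Proof. by have [p [-> _]] := zs_factor s; exists p. Qed.

Definition zs_split (s : S) : X * Y := xchoose (zs_factor_ex s).

(* y x = (y . x) (y @ x) *)
Definition zs_act (y : Y) (x : X) : X := (zs_split (zs_inr S y * zs_inl S x)).1.
Definition zs_at (y : Y) (x : X) : Y := (zs_split (zs_inr S y * zs_inl S x)).2.

Lemma zs_actE y x :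
  zs_inr S y * zs_inl S x = zs_inl S (zs_act y x) * zs_inr S (zs_at y x).
Proof. exact/eqP/(xchooseP (zs_factor_ex _)). Qed.

Lemma zs_inj x y x' y' :
  zs_inl S x * zs_inr S y = zs_inl S x' * zs_inr S y' -> x = x' /\ y = y'.
Proof.
move=> E; have [p [_ u]] := zs_factor (zs_inl S x * zs_inr S y).
by have := u (x', y') E; rewrite (u (x, y) erefl) => -[].
Qed.

Lemma zs_act1x x : zs_act 1 x = x.
Proof.
have := zs_actE 1 x.
by rewrite gmulf1 mul1g -[LHS]mulg1 -(gmulf1 (s := zs_inr S)) => /zs_inj[].
Qed.

Lemma zs_actx1 y : zs_act y 1 = 1.
Proof.
have := zs_actE y 1.
by rewrite gmulf1 mulg1 -[LHS]mul1g -(gmulf1 (s := zs_inl S)) => /zs_inj[].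
Qed.

Lemma zs_actMx y y' x : zs_act (y * y') x = zs_act y (zs_act y' x).
Proof.
have := zs_actE (y * y') x.
by rewrite gmulfM -mulgA zs_actE mulgA zs_actE -mulgA -gmulfM => /zs_inj[].
Qed.

Lemma zs_actxM y x x' : zs_act y (x * x') = zs_act y x * zs_act (zs_at y x) x'.
Proof.
have := zs_actE y (x * x').
by rewrite gmulfM mulgA zs_actE -mulgA zs_actE mulgA -gmulfM => /zs_inj[].
Qed.

End ZappaSzep.

Section SelfSimilar.
Variables (A : finType) (G : groupType) (S : zappa_szep (seq A) G).

Record self_similar : Prop := SelfSimilar {
  ss_faithful : forall g h : G,
    (forall w : seq A, zs_act S g w = zs_act S h w) -> g = h;
  (* G . A = A, as subsets of A^* *)
  ss_letters : forall w : seq A,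
    (exists g : G, exists b : A, w = zs_act S g [:: b]) <->
    (exists c : A, w = [:: c])
}.

(* The extension of the action to A^omega = (nat -> A): the n-th letter of g.x
   is that of g.(x_0 ... x_n), a word of length n.+1 (so the default value of
   nth is irrelevant); see omega_act_prefix. *)
Definition omega_act (g : G) (x : nat -> A) : nat -> A :=
  fun n => nth (x n) (zs_act S g (mkseq x n.+1)) n.

Definition Lan (a : A) (v : seq A) : Prop :=
  exists (g : G) (n : nat), v = mkseq (omega_act g (fun=> a)) n.

Lemma size_zs_act (hS : self_similar) g w : size (zs_act S g w) = size w.
Proof.
elim: w g => [|b w IH] g; first by rewrite (zs_actx1 S).
rewrite -cat1s (zs_actxM S g [:: b] w) !size_cat IH.
by have [c ->] := (ss_letters hS (zs_act S g [:: b])).1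
  (ex_intro _ g (ex_intro _ b erefl)).
Qed.

Lemma omega_act_prefix (hS : self_similar) g x n :
  mkseq (omega_act g x) n = zs_act S g (mkseq x n).
Proof.
elim: n => [|n IH]; first by rewrite (zs_actx1 S).
have E : mkseq x n.+1 = mkseq x n ++ [:: x n] by rewrite mkseqS cats1.
rewrite mkseqS IH {1}/omega_act E (zs_actxM S g (mkseq x n) [:: x n]).
rewrite nth_cat size_zs_act // size_mkseq ltnn subnn.
have := size_zs_act hS (zs_at S g (mkseq x n)) [:: x n].
by case: (zs_act S _ [:: x n]) => [|c [|]] //= _; rewrite -cats1.
Qed.

Lemma LanP (hS : self_similar) a v :
  Lan a v <-> exists (g : G) (k : nat), v = zs_act S g (nseq k a).
Proof.
have E k : mkseq (fun=> a) k = nseq k a.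
  by apply: (@eq_from_nth _ a) => [|i]; rewrite size_mkseq ?size_nseq // => ?;
    rewrite nth_mkseq // nth_nseq if_same.
by split=> -[g [k ->]]; exists g, k; rewrite omega_act_prefix // E.
Qed.

End SelfSimilar.

Definition Degree (A : finType) (L : seq A -> Prop) (v : seq A) : nat :=
  #|[pred b : A | `[< L (rcons v b) >]]|.

(* Main.v *)
Require Import Defs.
From mathcomp Require Import all_boot.
From mathcomp Require Import boolp.

(** Two closure properties of the language [Lan S a] carry the proof.

    It is stable under the action of [G], and [g] maps the one-letter
    extensions of [v] injectively to those of [g . v], by the letter
    permutation that the restriction [g @ v] induces.  Hence all words in the
    orbit of [a^n], that is all words of length [n] in the language, have the
    same degree [d_n] ([Degree_zs_act]).

    It is also closed under subwords, because [g . (a^k a^m)] splits as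
    [(g . a^k) ((g @ a^k) . a^m)] ([Lan_infix]).  Deleting the first letter of
    [a^n.+1 b] therefore shows that [d_n] is nonincreasing, so that it is
    constant, equal to some [d], from some length [T] on.

    For the local characterization of the language, take [c w b] with
    [w] of length at least [T] and [c w], [w b] in the language.  Every letter
    extending [c w] also extends [w], and both words have exactly [d]
    extensions, so the two sets of letters coincide and [b], which extends
    [w], extends [c w] too ([Lan_glue]).  Induction on the length concludes. *)

Lemma nonincr_eventually_constant {f : nat -> nat} :
  (forall n, f n.+1 <= f n) -> exists T, forall n, T <= n -> f n = f T.
Proof.
move=> fS.
have exm : exists m, `[< exists n, f n = m >].
  by exists (f 0); apply/asboolP; exists 0.
case: (ex_minnP exm) => m /asboolP[T fT] minm; exists T => n leTn.
apply/eqP; rewrite eqn_leq; apply/andP; split.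
  by apply: (homo_leq (r := fun x y => y <= x)) leTn => // y x z xy yz;
     apply: leq_trans yz xy.
by rewrite fT; apply: minm; apply/asboolP; exists n.
Qed.

Section LanTheory.
Set Implicit Arguments.
Unset Strict Implicit.
Variables (A : finType) (G : groupType) (S : zappa_szep (seq A) G).
Hypothesis hS : self_similar S.

(** The default value of [head] is never reached: [g . b] is a letter, see
    [zs_act_letter]. *)
Definition letter_act (g : G) (b : A) : A := head b (zs_act S g [:: b]).

Lemma zs_act_letter g b : zs_act S g [:: b] = [:: letter_act g b].
Proof.
rewrite /letter_act; have := size_zs_act hS g [:: b].
by case: (zs_act _ _ _) => [|c []].
Qed.

Lemma zs_actK g : cancel (zs_act S g) (zs_act S g^-1).
Proof. by move=> w; rewrite -zs_actMx mulVg zs_act1x. Qed.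

Lemma letter_act_inj g : injective (letter_act g).
Proof.
move=> b c E.
have /(can_inj (zs_actK g))[//] : zs_act S g [:: b] = zs_act S g [:: c].
by rewrite !zs_act_letter E.
Qed.

Lemma zs_act_cat g v w :
  zs_act S g (v ++ w) = zs_act S g v ++ zs_act S (zs_at S g v) w.
Proof. exact: zs_actxM. Qed.

Lemma zs_act_rcons g v b :
  zs_act S g (rcons v b) = rcons (zs_act S g v) (letter_act (zs_at S g v) b).
Proof. by rewrite -!cats1 zs_act_cat zs_act_letter. Qed.

Variable a : A.

Lemma Lan_zs_act g v : Lan S a v -> Lan S a (zs_act S g v).
Proof.
case/(LanP hS) => h [k ->]; apply/(LanP hS).
by exists (g * h)%g, k; rewrite zs_actMx.
Qed.

(** A suffix is in the orbit of a power of [a] because it is the image of such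
    a power under a restriction of the group element that produces the word. *)
Lemma Lan_cat v w : Lan S a (v ++ w) -> Lan S a v /\ Lan S a w.
Proof.
case/(LanP hS) => g [k E].
have szk : size v + size w = k by rewrite -size_cat E size_zs_act // size_nseq.
move: E; rewrite -szk nseqD zs_act_cat => /eqP.
rewrite eqseq_cat ?size_zs_act ?size_nseq // => /andP[/eqP Ev /eqP Ew].
split; apply/(LanP hS); first by exists g, (size v).
by exists (zs_at S g (nseq (size v) a)), (size w).
Qed.

Lemma Lan_infix u v : infix u v -> Lan S a v -> Lan S a u.
Proof. by case/infixP => [s [s' ->]] /Lan_cat[_ /Lan_cat[]]. Qed.

Lemma Degree_zs_act g v : Degree (Lan S a) (zs_act S g v) = Degree (Lan S a) v.
Proof.
(* The restriction of [h] at [w] injects the extensions of [w] into those of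
   [h . w]; using it for [g] and for its inverse gives both inequalities. *)
have le h w : Degree (Lan S a) w <= Degree (Lan S a) (zs_act S h w).
  rewrite /Degree -(card_image (@letter_act_inj (zs_at S h w))).
  apply: subset_leq_card; apply/subsetP => _ /imageP[b /asboolP Lwb ->].
  by apply/asboolP; rewrite -zs_act_rcons; apply: Lan_zs_act.
by apply/eqP; rewrite eqn_leq le andbT -{2}(zs_actK g v) le.
Qed.

Lemma Degree_Lan v :
  Lan S a v -> Degree (Lan S a) v = Degree (Lan S a) (nseq (size v) a).
Proof.
case/(LanP hS) => g [k ->].
by rewrite Degree_zs_act size_zs_act // size_nseq.
Qed.

Lemma ext_cons_sub c w :
  [pred b | `[< Lan S a (rcons (c :: w) b) >]]
    \subset [pred b | `[< Lan S a (rcons w b) >]].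
Proof.
apply/subsetP => b /asboolP; rewrite rcons_cons -cat1s => /Lan_cat[_ Lwb].
exact/asboolP.
Qed.

(** Equal degrees force the inclusion of extension sets in [ext_cons_sub] to
    be an equality, so that overlapping words of the language can be glued. *)
Lemma Lan_glue c w b :
  Degree (Lan S a) (c :: w) = Degree (Lan S a) w ->
  Lan S a (rcons w b) -> Lan S a (rcons (c :: w) b).
Proof.
move=> /(subset_cardP)/(_ (ext_cons_sub c w))/(_ b) E Lwb.
by apply/asboolP; move: E; rewrite !inE => ->; apply/asboolP.
Qed.

Lemma Degree_eventually_constant :
  exists T d, forall v, Lan S a v -> T <= size v -> Degree (Lan S a) v = d.
Proof.
have deg_nonincr n :
    Degree (Lan S a) (nseq n.+1 a) <= Degree (Lan S a) (nseq n a).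
  exact/subset_leq_card/ext_cons_sub.
have [T degT] := nonincr_eventually_constant deg_nonincr.
exists T, (Degree (Lan S a) (nseq T a)) => v Lv leTv.
by rewrite Degree_Lan // degT.
Qed.

Lemma Lan_local T d v :
  (forall w, Lan S a w -> T <= size w -> Degree (Lan S a) w = d) ->
  (forall u, infix u v -> size u <= T.+1 -> Lan S a u) -> Lan S a v.
Proof.
move=> degd; have [n] := ubnP (size v); elim: n v => // n IH v ltvn loc.
have [lev|gtv] := leqP (size v) T.+1; first exact: loc (infix_refl v) lev.
case: v => [//|c v'] in ltvn loc gtv *.
case/lastP: v' => [//|w b] in ltvn loc gtv *.
rewrite /= size_rcons !ltnS in ltvn gtv.
have Lfactor v' : infix v' (c :: rcons w b) -> size v' = (size w).+1 -> Lan S a v'.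
  move=> iv' szv'; apply: IH => [|u iu]; first by rewrite szv'.
  exact: loc (infix_trans iu iv').
have Lcw : Lan S a (c :: w).
  by apply: Lfactor => //; rewrite -rcons_cons; exact: infix_rcons.
have Lwb : Lan S a (rcons w b).
  by apply: Lfactor; rewrite ?size_rcons //; exact: infix_cons.
have Lw : Lan S a w by apply: Lan_infix Lcw; exact: infix_cons.
by apply: Lan_glue Lwb; rewrite !degd // ltnW.
Qed.

End LanTheory.

Theorem lemma3p4 (A : finType) (G : groupType) (S : zappa_szep (seq A) G)
    (hS : self_similar S) (a : A) :
  exists T d : nat,
    (forall v : seq A, Lan S a v -> (T <= size v)%N ->
       Degree (Lan S a) v = d) /\
    (forall v : seq A,
       Lan S a v <->
       (forall u : seq A, infix u v -> (size u <= T.+1)%N -> Lan S a u)).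
Proof.
have [T [d degd]] := Degree_eventually_constant hS a.
exists T, d; split=> // v; split=> [Lv u iu _|].
  exact: Lan_infix iu Lv.
exact: (Lan_local hS degd).
Qed.
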